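(* Let $\mathbb{D}$ be a division ring with an involution $x \mapsto x^\star$ that is not the identity. Let $n \geq 2$ be an integer. Then, unless $n=2$ and $|\mathbb{D}|=4$, every range-compatible homomorphism on $\mathrm{A}\mathcal{H}_n(\mathbb{D})$ is local.
   Context: Division rings are associative with unity $1\neq 0$ and not assumed commutative. An involution of $\mathbb{D}$ is an endomorphism $x\mapsto x^\star$ of the group $(\mathbb{D},+)$ with $(xy)^\star=y^\star x^\star$ and $(x^\star)^\star=x$ for all $x,y$. For $M=(m_{i,j})\in \mathrm{M}_n(\mathbb{D})$, set $M^\star:=(m_{j,i}^\star)$; $\mathrm{A}\mathcal{H}_n(\mathbb{D})$ denotes the additive group $\{M-M^\star \mid M \in \mathrm{M}_n(\mathbb{D})\}$ of alternate-Hermitian matrices. $\mathbb{D}^n$ is identified with the column matrices with $n$ rows and is viewed as a right $\mathbb{D}$-vector space. The range of a matrix $M\in \mathrm{M}_n(\mathbb{D})$ is the right $\mathbb{D}$-linear span of its columns in $\mathbb{D}^n$. For an additive subgroup $\mathcal{M}$ of $\mathrm{M}_n(\mathbb{D})$, a range-compatible homomorphism on $\mathcal{M}$ is a group homomorphism $F:(\mathcal{M},+)\to(\mathbb{D}^n,+)$ such that $F(M)$ belongs to the range of $M$ for all $M\in\mathcal{M}$. A mapping $F:\mathcal{M}\to\mathbb{D}^n$ is local if there exists $X\in\mathbb{D}^n$ such that $F(M)=MX$ for all $M\in\mathcal{M}$. *)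

(* Defs.v *)
From mathcomp Require Import all_boot all_order all_algebra.

Set Implicit Arguments.
Unset Strict Implicit.
Unset Printing Implicit Defensive.

Import GRing.Theory.
Local Open Scope ring_scope.

Definition division_ring (D : unitRingType) : Prop :=
  forall x : D, x != 0 -> x \is a GRing.unit.

Definition ring_involution (D : pzRingType) (star : D -> D) : Prop :=
  [/\ {morph star : x y / x + y},
      forall x y : D, star (x * y) = star y * star x
    & involutive star].

Definition star_mx (D : pzRingType) (star : D -> D) (n : nat) (M : 'M[D]_n) :
  'M[D]_n := \matrix_(i < n, j < n) star (M j i).

Definition alt_hermitian (D : pzRingType) (star : D -> D) (n : nat)
    (A : 'M[D]_n) : Prop :=
  exists M : 'M[D]_n, A = M - star_mx star M.

(* The library's scaling *: multiplies on the left; columns form a right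
   D-vector space, so scalars must act on the right. *)
Definition rscale (D : pzRingType) (n : nat) (v : 'cV[D]_n) (a : D) :
  'cV[D]_n := \col_(i < n) (v i 0 * a).

Definition in_range (D : pzRingType) (n : nat) (M : 'M[D]_n) (v : 'cV[D]_n) :
  Prop := exists a : 'I_n -> D, v = \sum_(j < n) rscale (col j M) (a j).

(* A map on an additive subgroup S of 'M_n is encoded as a total function of
   which only the values on S matter. *)
Definition range_compatible_hom (D : pzRingType) (n : nat)
    (S : 'M[D]_n -> Prop) (F : 'M[D]_n -> 'cV[D]_n) : Prop :=
  (forall M N : 'M[D]_n, S M -> S N -> F (M + N) = F M + F N) /\
  (forall M : 'M[D]_n, S M -> in_range M (F M)).

Definition local_map (D : pzRingType) (n : nat)
    (S : 'M[D]_n -> Prop) (F : 'M[D]_n -> 'cV[D]_n) : Prop :=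
  exists X : 'cV[D]_n, forall M : 'M[D]_n, S M -> F M = M *m X.

Definition has_card (T : Type) (m : nat) : Prop :=
  exists f : 'I_m -> T, bijective f.

(* Main.v *)
Require Import Defs.
From Stdlib Require Import Classical.
From HB Require Import structures.
From mathcomp Require Import all_boot all_order all_algebra.
From mathcomp Require Import ring.

(* Write a = w - w* with w* <> w. On the matrices x v x* - (x v x* )*, of rank
   at most 1, range-compatibility is a functional equation between the
   diagonal and off-diagonal parts of F. Restricting to two indices,
   normalizing by a local map and polarizing, the obstruction to locality is
   an additive map h with h(ts) = t h(s) + sigma(s) h(t), where
   sigma(s) = a s* a^-1. Associativity gives [t, sigma(r)] h(s) = 0, so h <> 0
   forces D to be commutative; then h(s) = c (s - s* ) in characteristic 2, and
   the functional equation leaves only the field with 4 elements. In that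
   field a third index kills the obstruction. *)

Set Implicit Arguments.
Unset Strict Implicit.
Unset Printing Implicit Defensive.

Import GRing.Theory.
Local Open Scope ring_scope.

(** * Elementary identities for an involution *)

Section Involution.
Variables (D : pzRingType) (star : D -> D).
Hypothesis hstar : ring_involution star.

Lemma involD : {morph star : x y / x + y}. Proof. by case: hstar. Qed.
Lemma involM x y : star (x * y) = star y * star x. Proof. by case: hstar. Qed.
Lemma involK : involutive star. Proof. by case: hstar. Qed.

Lemma invol0 : star 0 = 0.
Proof. by apply: (addrI (star 0)); rewrite -involD !addr0. Qed.

Lemma involN x : star (- x) = - star x.
Proof. by apply: (addrI (star x)); rewrite -involD !subrr invol0. Qed.

Lemma involB x y : star (x - y) = star x - star y.
Proof. by rewrite involD involN. Qed.

Lemma invol1 : star 1 = 1.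
Proof. by have := involM 1 (star 1); rewrite mul1r !involK mul1r. Qed.

Lemma invol_skew v : star (v - star v) = - (v - star v).
Proof. by rewrite involB involK opprB. Qed.

End Involution.

(** * The field with four elements as the only obstruction over a commutative field *)

Definition four_elements (D : pzRingType) (star : D -> D) (w : D) : Prop :=
  [/\ 1 + 1 = 0 :> D, star w = w + 1, w * w = w + 1
    & forall x : D, [\/ x = 0, x = 1, x = w | x = w + 1]].

(** Commutativity makes the twisted Leibniz rule for [f] so rigid that [f v] is a multiple of
    [v + star v] in characteristic 2. Computing [q] in two ways then leaves only two values for
    [v + star v], which bounds the field. *)
Lemma four_elements_field (K : fieldType) (star f al q ph : K -> K) (w t0 : K) :
    ring_involution star ->
    let a := w - star w in
    a != 0 ->
    (forall t v, f (t * v * star t) + q (t * (v - star v)) =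
       t * (ph v + al ((v - star v) * star t))) ->
    (forall t, f (t * a) = al (a * star t)) ->
    (forall t s, f (t * star s * a) = t * f (s * a) + s * f (t * a)) ->
    ph w = 0 -> f (t0 * a) != 0 ->
  four_elements star w.
Proof.
move=> hstar a a0 fq fal fM' phw ft0.
have starD := involD hstar; have starN := involN hstar.
have starK := involK hstar.
have star0 := invol0 hstar; have star1 := invol1 hstar.
have starM : {morph star : x y / x * y}.
  by move=> x y; rewrite (involM hstar) mulrC.
have f1 : f (1 * a) = 0.
  by have := fM' 1 1; rewrite star1 !mul1r -[X in X = _ -> _]addr0 => /addrI.
have fstar s : f (star s * a) = f (s * a).
  by have := fM' 1 s; rewrite f1 mulr0 addr0 !mul1r.
have fM t s : f (t * s * a) = t * f (s * a) + star s * f (t * a).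
  by have := fM' t (star s); rewrite starK fstar.
(* Expand [f (t * s * a)] and [f (s * t * a)] by [fM] and compare. *)
have fC t s : (t - star t) * f (s * a) = (s - star s) * f (t * a).
  have := fM t s; rewrite (mulrC t s) fM => h.
  rewrite !mulrBl; apply/eqP; rewrite subr_eq addrAC eq_sym subr_eq; apply/eqP.
  exact: h.
have fw : f (w * a) != 0.
  apply: contraNneq ft0 => fw0.
  have := fC w t0; rewrite fw0 mulr0 => h.
  by rewrite -(mulrI_eq0 _ (mulfI a0)) h.
(* Taking [s = star w] in [fC] shows that [a * f (w * a)] equals its opposite. *)
have two : 1 + 1 = 0 :> K.
  have := fC w (star w); rewrite fstar starK -/a => h.
  apply/eqP; have : (1 + 1) * (a * f (w * a)) == 0.
    by rewrite mulrDl mul1r {2}h; apply/eqP; rewrite /a; ring.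
  by rewrite !mulf_eq0 (negbTE a0) (negbTE fw) !orbF.
have dbl x : x + x = 0 :> K by rewrite -[x]mul1r -mulrDl two mul0r.
have opp x : - x = x :> K by apply: (addrI x); rewrite subrr dbl.
have stara : star a = a by rewrite /a starD starN starK !opp addrC.
(* One division by [a] comes from solving [fC w (v / a)] for [f v], the other from [v / a], since
   [a] is fixed by [star]. *)
pose c := f (w * a) / a / a.
have c0 : c != 0 by rewrite /c !mulf_neq0 ?invr_eq0.
have fE v : f v = c * (v + star v).
  have := fC w (v / a); rewrite divfK // -/a => h.
  have sV : star (v / a) = star v / a.
    by apply: (mulIf a0); rewrite divfK // -{2}stara -starM divfK.
  move: h; rewrite sV /c opp => h.
  by apply: (mulfI a0); rewrite h; field.
clearbody c.
have alE b : al b = c * (b + star b).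
  have -> : b = a * star (star (b / a)) by rewrite starK mulrC divfK.
  by rewrite -fal fE !starM !starK stara; ring.
have qE t v : q (t * (v + star v)) = t * ph v + c * (v + star v) * (t * t).
  have := fq t v; rewrite fE alE !starM !starD !starN !starK !opp => h.
  apply: (addrI (c * (t * v * star t + star t * star v * t))).
  by rewrite mulrA h; ring.
have qa t : q (t * a) = c * a * (t * t).
  by have := qE t w; rewrite phw mulr0 add0r -[star w]opp -/a.
have trace v : let b := v + star v in b = 0 \/ b = a.
  move=> b.
  (* The value [q (t * b)] is given both by [qE] and by [qa] at [t * b / a]. The left side is
     quadratic in [t] and the right side linear, so comparing [t = 1] with [t = w] kills the
     coefficient. *)
  have eqb t : c * b * (b - a) * (t * t) = a * t * ph v.
    have := qa (t * b / a); rewrite divfK // qE -/b => h.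
    have -> : a * t * ph v =
      a * (t * ph v + c * b * (t * t)) - a * (c * b * (t * t)) by ring.
    by rewrite h; field.
  have hw := eqb w; have := eqb 1; rewrite !mulr1 => h1.
  have : c * b * (b - a) * (w * (w - 1)) == 0.
    have -> : c * b * (b - a) * (w * (w - 1)) =
      c * b * (b - a) * (w * w) - w * (c * b * (b - a)) by ring.
    by rewrite hw h1; apply/eqP; ring.
  have w0 : w != 0.
    by apply: contraNneq a0; rewrite /a => ->; rewrite star0 subrr.
  have w1 : w - 1 != 0.
    rewrite subr_eq0; apply: contraNneq a0; rewrite /a => ->.
    by rewrite star1 subrr.
  rewrite !mulf_eq0 (negbTE c0) (negbTE w0) (negbTE w1) !orbF /= subr_eq0.
  by case/orP => /eqP; [left | right].
have wa : w + star w = a by rewrite -[star w]opp.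
(* The trace of [a * w] is [a * a], hence [0] or [a]. *)
have a1 : a = 1.
  have := trace (a * w); rewrite starM stara -mulrDr wa /= => -[/eqP|].
    by rewrite mulf_eq0 orbb (negbTE a0).
  by move=> h; apply: (mulfI a0); rewrite h mulr1.
have sw : star w = w + 1 by rewrite -a1 -wa addrA dbl add0r.
(* For a fixed [x], the trace of [x * w] is [x] itself. *)
have fixed x : star x = x -> x = 0 \/ x = 1.
  move=> xx; have := trace (x * w); rewrite starM xx -mulrDr wa a1 mulr1 /=.
  exact.
have w0 : w != 0 by apply: contraNneq a0; rewrite /a => ->; rewrite star0 subrr.
have w1 : w + 1 != 0.
  by rewrite -sw; apply: contraNneq w0 => h; rewrite -(starK w) h star0.
split => //.
  case: (fixed (w * star w)); first by rewrite starM starK mulrC.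
    by move/eqP; rewrite sw mulf_eq0 (negbTE w0) (negbTE w1).
  by rewrite sw mulrDr mulr1 => <-; rewrite addrCA dbl addr0.
(* Trace [0] means that [x] is fixed, and trace [1] that [x + w] is fixed. *)
move=> x; case: (trace x).
  move/eqP; rewrite addr_eq0 opp => /eqP/esym/fixed[].
    by constructor 1.
  by constructor 2.
rewrite a1 => h.
have sx : star x = x + 1 by rewrite -h addrA dbl add0r.
have : star (x + w) = x + w by rewrite starD sw sx addrACA two addr0.
case/fixed.
  by move/eqP; rewrite addr_eq0 opp => /eqP ->; constructor 3.
by move=> xw; constructor 4; rewrite -xw addrCA dbl addr0.
Qed.

(** * The two-index functional equation over a division ring *)

Section DivisionRing.
Variables (D : unitRingType) (star : D -> D).
Hypotheses (hD : division_ring D) (hstar : ring_involution star).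

Let involD := involD hstar.
Let involM := involM hstar.
Let involK := involK hstar.
Let invol0 := invol0 hstar.
Let invol1 := invol1 hstar.

Lemma division_ring_mulf_eq0 (x y : D) : x * y = 0 -> x != 0 -> y = 0.
Proof. by move=> xy /hD ux; apply: (mulrI ux); rewrite xy mulr0. Qed.

(** Transfer to a [fieldType] structure built on [D], where [ring] and [field] apply. *)
Lemma four_elements_of_commutative (f al q ph : D -> D) (w t0 : D) :
    (forall x y : D, x * y = y * x) ->
    let a := w - star w in
    a != 0 ->
    (forall t v, f (t * v * star t) + q (t * (v - star v)) =
       t * (ph v + al ((v - star v) * star t))) ->
    (forall t, f (t * a) = al (a * star t)) ->
    (forall t s, f (t * star s * a) = t * f (s * a) + s * f (t * a)) ->
    ph w = 0 -> f (t0 * a) != 0 ->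
  four_elements star w.
Proof.
move=> mulC a a0 fq fal fM phw ft0.
pose C := HB.pack_for comUnitRingType D
  (GRing.PzRing_hasCommutativeMul.Build D mulC).
have fieldC : GRing.field_axiom C by move=> x /hD.
pose K := HB.pack_for fieldType C
  (GRing.ComUnitRing_isField.Build C fieldC).
exact: (@four_elements_field K star f al q ph w t0).
Qed.

(** Meant for two indices [i != j]: [phi] and [psi] are the diagonal parts at [i] and [j], while [p]
    and [q] are the off-diagonal parts at [(i, j)] and [(j, i)]. *)
Lemma pair_vanishing (w : D) (phi psi p q : D -> D) :
    star w != w -> ~ four_elements star w ->
    {morph psi : x y / x + y} -> (forall v, psi (star v) = - psi v) ->
    {morph p : x y / x + y} -> {morph q : x y / x + y} ->
    (forall t v, psi (t * v * star t) + q (t * (v - star v)) =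
       t * (phi v + p ((v - star v) * star t))) ->
    phi w = 0 -> psi w = 0 ->
  (forall b, p b = 0) /\ (forall v, psi v = 0).
Proof.
move=> ww not4 psiD psi_skew pD qD E phiw psiw.
pose a := w - star w.
have a0 : a != 0 by rewrite subr_eq0 eq_sym.
have ua : a \is a GRing.unit by exact: hD.
have sa : star a = - a by exact: (invol_skew hstar).
have saV : star a^-1 = - a^-1.
  apply: (mulrI ua); rewrite mulrN divrr // -[a in a * _]opprK -sa mulNr.
  by rewrite -involM mulVr // invol1.
(* Subtracting the local map with coefficient [X] preserves the equation and gives [al a = 0]; at
   the end [X] itself turns out to be zero. *)
pose X := a^-1 * p a.
pose f v := psi v - (v - star v) * X.
pose al b := p b - b * X.
have psi0 : psi 0 = 0 by apply: (addrI (psi 0)); rewrite -psiD !addr0.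
have fD x y : f (x + y) = f x + f y.
  by rewrite /f psiD involD opprD addrACA mulrDl opprD addrACA.
have fN x : f (- x) = - f x.
  by apply: (addrI (f x)); rewrite -fD !subrr /f psi0 invol0 subrr mul0r subrr.
have f_skew v : f (star v) = - f v.
  by rewrite /f psi_skew involK -[star v - v]opprB mulNr opprK opprB addrC.
have alD x y : al (x + y) = al x + al y.
  by rewrite /al pD mulrDl opprD addrACA.
have Ef t v : f (t * v * star t) + q (t * (v - star v)) =
    t * (phi v + al ((v - star v) * star t)).
  have -> : f (t * v * star t) =
      psi (t * v * star t) - t * ((v - star v) * star t * X).
    by rewrite /f !involM involK !mulrBl mulrBr !mulrA.
  by rewrite addrAC E /al addrA mulrBr.
have ala : al a = 0 by rewrite /al mulrA divrr // mul1r subrr.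
(* Polarization of [Ef] at [v = w]: the additive [q] cancels, and [f_skew] merges the two cross
   terms [t * w * star s] and [s * w * star t] into one term in [a]. *)
have pol t s : f (t * a * star s) = t * al (a * star s) + s * al (a * star t).
  have Ew r : f (r * w * star r) = r * al (a * star r) - q (r * a).
    by apply/eqP; rewrite eq_sym subr_eq Ef phiw add0r.
  have split_f : f ((t + s) * w * star (t + s)) =
      f (t * w * star t) + f (s * w * star s) + f (t * a * star s).
    have -> : t * a * star s = t * w * star s - star (s * w * star t).
      by rewrite !involM involK mulrBr mulrBl !mulrA.
    rewrite involD 2!mulrDl mulrDr [s * w * _]mulrDr !fD fN f_skew opprK.
    by rewrite [X in _ + X = _]addrC addrACA.
  move: split_f; rewrite !Ew involD [a * _]mulrDr alD [(t + s) * (_ + _)]mulrDr.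
  rewrite ![(t + s) * _]mulrDl qD opprD => sum_f.
  apply: (addrI (t * al (a * star t) - q (t * a) +
                 (s * al (a * star s) - q (s * a)))).
  by rewrite -sum_f [LHS](AC (2*2*2) ((1*5)*(4*6)*(3*2))).
have fal t : f (t * a) = al (a * star t).
  by have := pol t 1; rewrite invol1 !mulr1 ala mulr0 add0r mul1r.
have conjE s : a * star s * a^-1 * a = a * star s by rewrite mulrVK.
have fM t s : f (t * (a * star s * a^-1) * a) = t * f (s * a) + s * f (t * a).
  by rewrite -mulrA conjE mulrA pol !fal.
have f_conj s : f (a * star s * a^-1 * a) = f (s * a).
  by have := pol 1 s; rewrite conjE fal invol1 mulr1 ala mulr0 addr0 !mul1r.
(* Apply [fM] to the twist of [s]: twisting twice is the identity because [star a = - a]. *)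
have fM' t s : f (t * s * a) = t * f (s * a) + (a * star s * a^-1) * f (t * a).
  rewrite -[in RHS]f_conj -fM; congr (f (_ * _ * _)).
  rewrite !involM saV involK sa !mulrA !mulrN !mulNr opprK.
  by rewrite mulrK // mulrV // mul1r.
have vanish t : f (t * a) = 0.
  apply/eqP; apply: contra_notT not4 => ft.
  have central r s : s * (a * star r * a^-1) = (a * star r * a^-1) * s.
    (* Expand [f (s * t * r * a)] along both bracketings of the product; the twist reverses
       products, so all other terms cancel. *)
    have : (s * (a * star r * a^-1) - (a * star r * a^-1) * s) * f (t * a) = 0.
      have conjM :
          a * star (t * r) * a^-1 = a * star r * a^-1 * (a * star t * a^-1).
        by rewrite involM !mulrA mulrVK.
      have := fM' (s * t) r; rewrite -[s * t * r]mulrA !fM' conjM.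
      move: (a * star r * a^-1) (a * star t * a^-1) => A B.
      move: (f (r * a)) (f (t * a)) (f (s * a)) => u v x.
      rewrite !mulrDr !mulrA addrA => /addIr/addrI.
      by rewrite mulrBl => ->; rewrite subrr.
    move=> sr; apply/eqP; rewrite -subr_eq0; apply/eqP.
    by apply: contraNeq ft => /division_ring_mulf_eq0 => /(_ _ sr) ->.
  have mulC (x y : D) : x * y = y * x.
    (* The twist is onto: this argument is sent to [y]. *)
    have := central (star (a^-1 * y * a)) x.
    by rewrite involK -[a^-1 * y * a]mulrA mulVKr // mulrK.
  apply: (@four_elements_of_commutative f al q phi w t) => //.
  by move=> t1 s; rewrite -fM -[a * _]mulC mulrK.
have f0 v : f v = 0 by rewrite -(mulrVK ua v).
have al0 b : al b = 0.
  by rewrite -[b](mulVKr ua) -[a^-1 * b]involK -fal.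
have X0 : X = 0.
  apply: (@division_ring_mulf_eq0 a) => //.
  by have := f0 w; rewrite /f psiw sub0r => /eqP; rewrite oppr_eq0 => /eqP.
by split=> v; [have := al0 v | have := f0 v]; rewrite /al /f X0 mulr0 subr0.
Qed.

(** * Entrywise analysis of range-compatible homomorphisms *)

Section RangeCompatible.
Variables (n : nat) (G : 'M[D]_n -> 'cV[D]_n).
Hypothesis GD : {morph G : M N / M + N}.
Hypothesis G_range : forall M, in_range (M - star_mx star M) (G M).

(** [G] takes an arbitrary matrix and is range-compatible with its alternate part, so single-entry
    matrices are legitimate arguments. *)
Definition entry_part (i j : 'I_n) (b : D) : D := G (b *: delta_mx i j) i 0.
Notation P := entry_part.

Lemma in_range_row0 (M : 'M[D]_n) (v : 'cV[D]_n) i :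
  in_range M v -> (forall j, M i j = 0) -> v i 0 = 0.
Proof.
by move=> [r ->] Mi; rewrite summxE big1 // => j _; rewrite !mxE Mi mul0r.
Qed.

Lemma hom0 : G 0 = 0.
Proof. by apply: (addrI (G 0)); rewrite -GD !addr0. Qed.

Lemma homN M : G (- M) = - G M.
Proof. by apply: (addrI (G M)); rewrite -GD !subrr hom0. Qed.

(** The alternate part of [M + star_mx star M] is zero, and so is its range. *)
Lemma hom_star_mx M : G (star_mx star M) = - G M.
Proof.
apply/eqP; rewrite -addr_eq0 -GD; apply/eqP/matrixP => i k; rewrite ord1 mxE.
apply: (in_range_row0 (G_range _)) => j.
by rewrite !mxE involD involK [X in _ - X]addrC subrr.
Qed.

Lemma entry_partD i j : {morph P i j : x y / x + y}.
Proof. by move=> x y; rewrite /P scalerDl GD mxE. Qed.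

Lemma entry_part0 i j : P i j 0 = 0.
Proof. by rewrite /P scale0r hom0 mxE. Qed.

Lemma entry_partN i j x : P i j (- x) = - P i j x.
Proof. by rewrite /P scaleNr homN mxE. Qed.

Lemma star_mx_delta b i j :
  star_mx star (b *: delta_mx i j : 'M[D]_n) = star b *: delta_mx j i.
Proof.
apply/matrixP => k l; rewrite !mxE andbC.
by case: (_ && _); rewrite ?mulr1 // !mulr0 invol0.
Qed.

Lemma hom_delta_out b i j k : k != i -> k != j ->
  G (b *: delta_mx i j) k 0 = 0.
Proof.
move=> ki kj; apply: (in_range_row0 (G_range _)) => l.
by rewrite star_mx_delta !mxE (negbTE ki) (negbTE kj) !mulr0 subrr.
Qed.

Lemma hom_delta_tr b i j : G (b *: delta_mx j i) i 0 = - P i j (star b).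
Proof. by rewrite /P -star_mx_delta hom_star_mx mxE opprK. Qed.

Lemma hom_sum (I : Type) (r : seq I) (Q : pred I) (H : I -> 'M[D]_n) :
  G (\sum_(i <- r | Q i) H i) = \sum_(i <- r | Q i) G (H i).
Proof. by elim/big_rec2: _ => [|i y x _ <-]; rewrite ?hom0 ?GD. Qed.

(** Entries outside row [i] and column [i] leave row [i] of the alternate part zero; those of column
    [i] are moved to row [i] by [hom_delta_tr]. *)
Lemma hom_entry (M : 'M[D]_n) i :
  G M i 0 = P i i (M i i) + \sum_(j | j != i) P i j (M i j - star (M j i)).
Proof.
rewrite {1}[M]matrix_sum_delta hom_sum summxE (bigD1 i) //=.
rewrite hom_sum summxE (bigD1 i) //= -addrA; congr (_ + _).
rewrite -big_split /=; apply: eq_bigr => j ji.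
rewrite entry_partD entry_partN; congr (_ + _).
rewrite hom_sum summxE (bigD1 i) //= hom_delta_tr big1 ?addr0 // => l li.
by rewrite hom_delta_out // eq_sym.
Qed.

(** The matrix with entries [x i * v * star (x j)] has an alternate part whose columns are all right
    multiples of [x], so a single [r] serves every row. *)
Lemma rank_one_relation (x : 'I_n -> D) (v : D) :
  exists r, forall i,
    P i i (x i * v * star (x i)) +
      \sum_(j | j != i) P i j (x i * (v - star v) * star (x j)) = x i * r.
Proof.
pose M : 'M[D]_n := \matrix_(i, j) (x i * v * star (x j)).
have [r rE] := G_range M.
exists (\sum_j (v - star v) * star (x j) * r j) => i.
have MM j : M i j - star (M j i) = x i * (v - star v) * star (x j).
  by rewrite !mxE !involM involK mulrBr mulrBl !mulrA.
have := hom_entry M i; rewrite {1}rE summxE mxE.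
under [X in _ = _ + X]eq_bigr do rewrite MM.
move=> <-; rewrite mulr_sumr; apply: eq_bigr => j _.
by rewrite mxE [col _ _ _ _]mxE !mulrA -MM !mxE.
Qed.

(** Take [x] equal to [1] at [i], [t] at [j] and [0] elsewhere: row [i] computes [r], which is then
    substituted in row [j]. *)
Lemma pair_relation i j t v : i != j ->
  P j j (t * v * star t) + P j i (t * (v - star v)) =
    t * (P i i v + P i j ((v - star v) * star t)).
Proof.
move=> ij; have ji : j != i by rewrite eq_sym.
pose x k := if k == i then 1 else if k == j then t else 0 : D.
have xi : x i = 1 by rewrite /x eqxx.
have xj : x j = t by rewrite /x eqxx (negbTE ji).
have x0 l : l != i -> l != j -> x l = 0.
  by move=> li lj; rewrite /x (negbTE li) (negbTE lj).
clearbody x; have [r rE] := rank_one_relation x v.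
have := rE j; rewrite (bigD1 i) //= big1 ?addr0 ?xj ?xi; last first.
  by move=> l /andP[lj li]; rewrite x0 // invol0 mulr0 entry_part0.
have := rE i; rewrite (bigD1 j) //= big1 ?addr0 ?xj ?xi; last first.
  by move=> l /andP[li lj]; rewrite x0 // invol0 mulr0 entry_part0.
by rewrite invol1 !mulr1 !mul1r => -> ->.
Qed.

Lemma triple_relation i j k s t v : i != j -> j != k -> i != k ->
  P j j (s * v * star s) + P j i (s * (v - star v)) +
      P j k (s * (v - star v) * star t) =
    s * (P i i v + P i j ((v - star v) * star s) +
         P i k ((v - star v) * star t)).
Proof.
move=> ij jk ik.
have [ji kj ki] : [/\ j != i, k != j & k != i].
  by rewrite ![_ == i]eq_sym [k == j]eq_sym.
pose x l : D :=
  if l == i then 1 else if l == j then s else if l == k then t else 0.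
have xi : x i = 1 by rewrite /x eqxx.
have xj : x j = s by rewrite /x eqxx (negbTE ji).
have xk : x k = t by rewrite /x eqxx (negbTE ki) (negbTE kj).
have x0 l : l != i -> l != j -> l != k -> x l = 0.
  by move=> li lj lk; rewrite /x (negbTE li) (negbTE lj) (negbTE lk).
clearbody x; have [r rE] := rank_one_relation x v.
have := rE j.
rewrite (bigD1 i) // (bigD1 k) ?kj //= big1 ?addr0 ?xj ?xi ?xk; last first.
  by move=> l /andP[/andP[lj li] lk]; rewrite x0 // invol0 mulr0 entry_part0.
have := rE i.
rewrite (bigD1 j) // (bigD1 k) ?ki //= big1 ?addr0 ?xj ?xi ?xk; last first.
  by move=> l /andP[/andP[li lj] lk]; rewrite x0 // invol0 mulr0 entry_part0.
by rewrite invol1 !mulr1 !mul1r !addrA => -> ->.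
Qed.

(** * Vanishing of the entry parts *)

Lemma hom_vanishing (M : 'M[D]_n) :
  (forall i j b, P i j b = 0) -> G M = 0.
Proof.
move=> P0; apply/matrixP => i k; rewrite ord1 hom_entry P0 add0r mxE.
by rewrite big1.
Qed.

Lemma entry_part_eq0_not_four (w : D) :
    star w != w -> ~ four_elements star w -> (2 <= n)%N ->
    (forall i, P i i w = 0) ->
  forall i j b, P i j b = 0.
Proof.
move=> ww not4 n2 Pw.
have van i j : i != j -> (forall b, P i j b = 0) /\ (forall b, P j j b = 0).
  move=> ij; apply: (@pair_vanishing w (P i i) _ _ (P j i)) => //.
  - exact: entry_partD.
  - by move=> v; rewrite {1}/P hom_delta_tr involK.
  - exact: entry_partD.
  - exact: entry_partD.
  - by move=> t v; exact: pair_relation.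
move=> i j b; have [<-|ij] := eqVneq i j; last exact: (van i j ij).1.
have [k ki] : exists k, k != i.
  have /card_gt0P[k] : (0 < #|[set~ i]|)%N.
    by rewrite cardsC1 card_ord -ltnS prednK // ltnW.
  by rewrite !inE; exists k.
exact: (van k i ki).2.
Qed.

(** A third index forces the off-diagonal parts to be left linear, which is incompatible with the
    twisted symmetry [tr] unless they vanish. *)
Lemma entry_part_eq0_four (w : D) :
    four_elements star w -> (2 < n)%N -> (forall i, P i i w = 0) ->
  forall i j b, P i j b = 0.
Proof.
case=> two sw ww elts n3 Pw.
have dbl x : x + x = 0 :> D by rewrite -[x]mul1r -mulrDl two mul0r.
have a1 : w - star w = 1.
  rewrite sw opprD addNKr; apply: (addrI 1); by rewrite two subrr.
have diag i v : P i i v = 0.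
  (* [P i i] is skew under [star] and [star w = w + 1], so its vanishing at [w] propagates to
     [1]. *)
  have P1 : P i i 1 = 0.
    have := hom_delta_tr w i i; rewrite -/(P i i w) sw entry_partD Pw add0r.
    by move/eqP; rewrite eq_sym oppr_eq0 => /eqP.
  by case: (elts v) => ->; rewrite ?entry_partD ?entry_part0 ?Pw ?P1 ?addr0.
have tr i j t : i != j -> P j i t = t * P i j (star t).
  move=> ij; have := pair_relation t w ij.
  by rewrite a1 !diag !add0r mulr1 mul1r.
(* In the triple relation with [t = 1], the terms in [(i, j)] and [(j, i)] cancel by [tr]. *)
have lin i j k s : i != j -> j != k -> i != k -> P j k s = s * P i k 1.
  move=> ij jk ik; have := triple_relation s 1 w ij jk ik.
  by rewrite a1 !diag !add0r invol1 !mulr1 !mul1r mulrDr -tr // => /addrI.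
move=> j k b; have [<-|jk] := eqVneq j k; first exact: diag.
have [i ij ik] : exists2 i, i != j & i != k.
  have /card_gt0P[i] : (0 < #|~: [set j; k]|)%N.
    by rewrite cardsCs setCK cards2 jk card_ord subn_gt0.
  by rewrite !inE negb_or => /andP[]; exists i.
have linjk s : P j k s = s * P j k 1.
  by rewrite (lin i) // (lin i j k 1) // mul1r.
have kj : k != j by rewrite eq_sym.
have linkj s : P k j s = s * P k j 1.
  by rewrite (lin i) // (lin i k j 1) // mul1r.
have sym : P k j 1 = P j k 1 by rewrite tr // invol1 mul1r.
(* Both sides are [P k j w], by linearity and by [tr]. As [w * star w = 1], the value [P j k 1] is
   fixed by left multiplication by [w], which is not [1]. *)
have wd : w * P j k 1 = w * (star w * P j k 1).
  by rewrite -(linjk (star w)) -(tr j k) // linkj sym.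
have w_sw : w * star w = 1 by rewrite sw mulrDr mulr1 ww addrAC dbl add0r.
have P1 : P j k 1 = 0.
  move: wd; rewrite mulrA w_sw mul1r; move: (P j k 1) => d wd.
  by rewrite -[LHS]mul1r -w_sw -mulrA sw mulrDl wd mul1r dbl mulr0.
by rewrite linjk P1 mulr0.
Qed.
End RangeCompatible.

(** Distinctness of the four listed values is not part of [four_elements]; it follows from [1 != 0],
    the equation for [w * w] and the fact that [star] is an involution. *)
Lemma four_elements_card (w : D) : four_elements star w -> has_card D 4.
Proof.
case=> two sw ww elts.
have w0 : w != 0.
  apply: contraNneq (oner_neq0 D) => w0.
  by move: ww; rewrite w0 mul0r add0r => <-.
have w1 : w != 1.
  apply: contraNneq (oner_neq0 D) => w1.
  by move: ww; rewrite w1 mulr1 two => ->.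
have sw0 : w + 1 != 0.
  by apply: contraNneq w0 => w10; rewrite -[w]involK sw w10 invol0.
pose s := [:: 0; 1; w; w + 1].
have us : uniq s.
  rewrite /= !inE !negb_or ![1 == _]eq_sym ![0 == _]eq_sym.
  rewrite oner_neq0 w0 sw0 w1 /= andbT.
  by rewrite -subr_eq0 addrK w0 eq_sym -subr_eq0 [w + 1]addrC addrK oner_neq0.
have sP x : x \in s by rewrite !inE; case: (elts x) => ->; rewrite eqxx ?orbT.
exists (fun i : 'I_4 => nth 0 s i); exists (fun x => inord (index x s)).
- by move=> i; rewrite index_uniq ?inord_val // ltn_ord.
- by move=> x; rewrite inordK ?nth_index //; have := sP x; rewrite -index_mem.
Qed.
End DivisionRing.

Theorem theorem1p3 (D : unitRingType) (star : D -> D) (n : nat)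
    (hD : division_ring D) (hstar : ring_involution star)
    (hstar_id : ~ (star =1 id)) (hn : (2 <= n)%N)
    (hexc : ~ (n = 2%N /\ has_card D 4)) :
  forall F : 'M[D]_n -> 'cV[D]_n,
    range_compatible_hom (alt_hermitian star (n:=n)) F ->
    local_map (alt_hermitian star (n:=n)) F.
Proof.
move=> F [FD F_range].
have [w ww] : exists w, star w <> w by apply: not_all_ex_not.
have {}ww : star w != w by apply/eqP.
have star_mxD (M N : 'M[D]_n) :
    star_mx star (M + N) = star_mx star M + star_mx star N.
  by apply/matrixP=> i j; rewrite !mxE (involD hstar).
pose alt (M : 'M[D]_n) := M - star_mx star M.
have altD M N : alt (M + N) = alt M + alt N.
  by rewrite /alt star_mxD opprD addrACA.
have alt_in M : alt_hermitian star (alt M) by exists M.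
(* The alternate part of [w *: delta_mx i i] is [(w - star w) *: delta_mx i i], so this [X] is the
   one vector for which the diagonal parts of [G] vanish at [w]. *)
pose X : 'cV[D]_n := \col_i ((w - star w)^-1 * F (alt (w *: delta_mx i i)) i 0).
pose G M := F (alt M) - alt M *m X.
have GD : {morph G : M N / M + N}.
  by move=> M N; rewrite /G altD FD // mulmxDl opprD addrACA.
have G_range M : in_range (M - star_mx star M) (G M).
  have [r rE] := F_range _ (alt_in M).
  exists (fun j => r j - X j 0); rewrite /G rE; apply/matrixP => i k.
  rewrite ord1 !mxE !summxE -sumrB; apply: eq_bigr => j _.
  by rewrite !mxE mulrBr.
have ua : w - star w \is a GRing.unit by apply: hD; rewrite subr_eq0 eq_sym.
have Gw i : entry_part G i i w = 0.
  have altw : alt (w *: delta_mx i i) = (w - star w) *: delta_mx i i.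
    by rewrite /alt (star_mx_delta hstar) scalerBl.
  have dii : ((w - star w) *: delta_mx i i : 'M[D]_n) i i = w - star w.
    by rewrite !mxE !eqxx mulr1.
  rewrite /entry_part /G mxE [X in _ + X]mxE [(alt _ *m _) i 0]mxE.
  rewrite (bigD1 i) //= big1 ?addr0.
    by rewrite [X i 0]mxE altw dii mulVKr // subrr.
  by move=> j ji; rewrite altw !mxE (negbTE ji) andbF mulr0 mul0r.
have G0 M : G M = 0.
  apply: (hom_vanishing hstar GD G_range).
  (* In the field with four elements, the excluded case [n = 2] leaves at least three indices. *)
  case: (classic (four_elements star w)) => [four|not4].
    apply: (entry_part_eq0_four hstar GD G_range four) => //.
    rewrite ltn_neqAle hn andbT; apply/eqP => n2; apply: hexc; split=> //.
    exact: (four_elements_card hstar four).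
  exact: (entry_part_eq0_not_four hD hstar GD G_range ww not4).
exists X => _ [M ->]; apply/eqP; rewrite -subr_eq0; exact/eqP/(G0 M).
Qed.
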